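(* Let $A$ be a $C^*$-algebra. The following are equivalent: (i) The set of all $a\in A$ for which there exists a finite-dimensional irreducible representation $\pi$ of $A$ with $\|\pi(a)\|=\|a\|$, that is, the set $$\{a\in A:\ \|a\|=\max_{\pi\in \mathrm{Irr}_n(A),\ n<\infty}\|\pi(a)\|\},$$ is dense in $A$. (ii) $A$ is residually finite-dimensional (RFD).
   Context: A representation of a $C^*$-algebra $A$ is a $*$-homomorphism $\pi:A\to B(\mathcal{H})$, $\mathcal{H}$ a Hilbert space; its dimension is $\dim\mathcal{H}$. $\mathrm{Irr}_n(A)$ denotes the set of irreducible representations of $A$ of dimension $n$; the maximum is over all irreducible representations of $A$ of any finite dimension $n$, and writing ''max'' means that it is attained. A family of representations of $A$ is separating if for every nonzero $a\in A$ some member $\pi$ of the family satisfies $\pi(a)\neq 0$. $A$ is residually finite-dimensional (RFD) if it has a separating family of finite-dimensional representations. *)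

(* Defs.v *)
From HB Require Import structures.
From mathcomp Require Import all_boot all_order all_algebra.
From mathcomp Require Import complex.
From mathcomp Require Import all_classical all_reals all_analysis.

Set Implicit Arguments.
Unset Strict Implicit.
Unset Printing Implicit Defensive.

Import Order.TTheory GRing.Theory Num.Theory.
Import numFieldNormedType.Exports.

Local Open Scope classical_set_scope.
Local Open Scope ring_scope.

(* Complex C*-algebras, not assumed to be unital (so MathComp's ring
   structures, which have a unit, do not apply).  The norm of a normed module
   over R[i] takes its values in R[i], in the nonnegative reals. *)
HB.mixin Record isCStarAlgebra (R : realType) A
    & CompleteNormedModule R[i] A := {
  cmul : A -> A -> A;
  cstar : A -> A;
  cmulA : associative cmul;
  cmulDl : left_distributive cmul +%R;
  cmulDr : right_distributive cmul +%R;
  cmulZl : forall (k : R[i]) (a b : A), cmul (k *: a) b = k *: cmul a b;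
  cmulZr : forall (k : R[i]) (a b : A), cmul a (k *: b) = k *: cmul a b;
  cnormM : forall a b : A, `|cmul a b| <= `|a| * `|b|;
  cstarK : involutive cstar;
  cstarD : {morph cstar : a b / a + b};
  cstarZ : forall (k : R[i]) (a : A), cstar (k *: a) = Num.conj k *: cstar a;
  cstarM : forall a b : A, cstar (cmul a b) = cmul (cstar b) (cstar a);
  cnorm_star : forall a : A, `|cmul (cstar a) a| = `|a| ^+ 2
}.

#[short(type="cstarAlgType")]
HB.structure Definition CStarAlgebra (R : realType) :=
  {A of CompleteNormedModule R[i] A & isCStarAlgebra R A}.

(* Finite-dimensional Hilbert spaces.  In finite dimension completeness is
   automatic, every linear map is bounded, so that B(H) is 'End(H), and every
   subspace is closed.  The inner product is linear on the left and
   conjugate-linear on the right. *)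
Record fdHilbert (R : realType) := FdHilbert {
  hspace :> vectType R[i];
  hdot : {dot hspace for Num.conj}
}.

Definition hnorm (R : realType) (H : fdHilbert R) (x : H) : R :=
  Num.sqrt (complex.Re (hdot H x x)).

Definition opnorm (R : realType) (H : fdHilbert R) (T : 'End(H)) : R :=
  sup [set hnorm (T x) | x in [set x : H | hnorm x <= 1]].

Record fdrep (R : realType) (A : cstarAlgType R) := FdRep {
  rep_space : fdHilbert R;
  rep_map :> {linear A -> 'End(rep_space)};
  repM : forall a b : A, rep_map (cmul a b) = (rep_map a \o rep_map b)%VF;
  (* rep_map (cstar a) is the adjoint of rep_map a *)
  rep_star : forall (a : A) (x y : rep_space),
    hdot rep_space (rep_map a x) y = hdot rep_space x (rep_map (cstar a) y)
}.

Definition rep_dim (R : realType) (A : cstarAlgType R) (pi : fdrep A) : nat :=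
  \dim {: rep_space pi}.

(* The zero representation on a one-dimensional space counts as irreducible,
   as in Dixmier's and Murphy's textbooks; it is the only irreducible
   representation of the zero algebra. *)
Definition irreducible (R : realType) (A : cstarAlgType R) (pi : fdrep A) :
    Prop :=
  rep_dim pi <> 0%N /\
  forall V : {vspace rep_space pi},
    (forall a : A, (pi a @: V <= V)%VS) -> V = 0%VS \/ V = {: rep_space pi}%VS.

Definition Irr (R : realType) (A : cstarAlgType R) (n : nat) (pi : fdrep A) : Prop :=
  irreducible pi /\ rep_dim pi = n.

Definition fd_norm_attaining (R : realType) (A : cstarAlgType R) : set A :=
  [set a | exists n : nat, exists2 pi : fdrep A,
     Irr n pi & `|a| = (opnorm (pi a))%:C%C].

Definition separating (R : realType) (A : cstarAlgType R)
    (F : fdrep A -> Prop) : Prop :=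
  forall a : A, a != 0 -> exists2 pi : fdrep A, F pi & pi a != 0.

Definition RFD (R : realType) (A : cstarAlgType R) : Prop :=
  exists F : fdrep A -> Prop, separating F.

(* Main.v *)
Require Import Defs.
From HB Require Import structures.
From mathcomp Require Import all_boot all_order all_algebra.
From mathcomp Require Import complex ring lra.
From mathcomp Require Import all_classical all_reals all_analysis.

(** Density implies residual finite-dimensionality because representations are
contractive: if a nonzero a died in every finite-dimensional representation,
an element b attaining its norm in pi would satisfy
|b| = |pi(b)| = |pi(b - a)| <= |b - a|, which fails for b close to a.

For the converse, the maps pi jointly embed A, and two things are needed: this
embedding is isometric, and an element a can be moved slightly so that its norm
does not exceed the norm it already has in one chosen representation.  Both
follow from a single construction: for a self-adjoint g with |g|^2 <= 2 and
t = g^2, the algebra contains the excess e = (t - 1)_+, an element with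
t e = e^2 + e and |t - 2 e| <= 1 ([excess_exists]).  It is built without
functional calculus.  A contraction x has an element X with
1 - x = (1 - X)^2, the limit of X := (x + X^2) / 2 ([one_sub_sqrt]); applied to
x = 2 t - t^2 it gives 1 - X = |1 - t|, and e = (t - X) / 2.  That x is a
contraction is checked by writing it as p^2 with p self-adjoint: then
(1 - t)^2 + p^2 = 1, so (1 - t) + i p is unitary and |p| <= 1
([le1_of_sum_squares]).

Isometry.  If t <= 1 in every representation, then e vanishes in each of them
([excess_eq0]), hence e = 0 and |t| = |t - 2 e| <= 1.  So a self-adjoint g
which is contractive in every representation and has |g| <= sqrt 2 is
contractive; scaling removes the second condition ([sa_norm_le]).  Orthogonal
decomposition shows that irreducible representations suffice
([bounded_by_irreducible]).

Perturbation.  Choose an irreducible pi with |pi(a)| close to |a|, rescale so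
that |pi(a)| = 1, and take g = a^* a, t = g^2 and b = a - a e.  Since t <= 1 in
pi, pi(e) = 0 and pi(b) = pi(a) has norm 1.  Since |a| is close to 1, e is
small ([excess_le]), so b is close to a.  Finally t (1 - e)^2 <= 1 in every
representation ([excess_weight_le1]), whence |b| <= 1 = |pi(b)|
([attaining_near]).

The algebra need not have a unit: 1 - X above only acts on A by multiplication.
*)

Set Implicit Arguments.
Unset Strict Implicit.
Unset Printing Implicit Defensive.

Import Order.TTheory GRing.Theory Num.Theory.
Import numFieldNormedType.Exports.

Local Open Scope classical_set_scope.
Local Open Scope complex_scope.
Local Open Scope ring_scope.

(** * Linear identities in abelian groups *)

(** The square-zero extension of the integers by an abelian group V is a
commutative ring into which V embeds additively, so a decision procedure for
commutative rings settles linear identities in V. *)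
Section TrivialExtension.
Variable V : zmodType.

Definition trivext : Type := (int * V)%type.
HB.instance Definition _ := GRing.Zmodule.on trivext.
Implicit Types p q : trivext.

Definition trivext_one : trivext := (1, 0).
Definition trivext_mul p q : trivext := (p.1 * q.1, q.2 *~ p.1 + p.2 *~ q.1).

Lemma trivext_mulA : associative trivext_mul.
Proof.
move=> [k u] [l v] [m w]; congr pair; rewrite /= ?mulrA //.
by rewrite !mulrzDl -!mulrzA addrA (mulrC l k) (mulrC m k).
Qed.

Lemma trivext_mulC : commutative trivext_mul.
Proof. by move=> p q; congr pair; [rewrite mulrC | rewrite addrC]. Qed.

Lemma trivext_mul1 : left_id trivext_one trivext_mul.
Proof. by move=> [k u]; rewrite /trivext_mul /= mul1r mul0rz addr0. Qed.

Lemma trivext_mulDl : left_distributive trivext_mul +%R.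
Proof.
move=> [k u] [l v] [m w]; congr pair; rewrite /= ?mulrDl //.
by rewrite mulrzDl mulrzDr addrACA.
Qed.

Lemma trivext_one_neq0 : trivext_one != 0.
Proof. by []. Qed.

HB.instance Definition _ := GRing.Zmodule_isComNzRing.Build trivext
  trivext_mulA trivext_mulC trivext_mul1 trivext_mulDl trivext_one_neq0.

Definition infl (v : V) : trivext := (0, v).

Lemma infl_inj : injective infl.
Proof. by move=> u v []. Qed.

Lemma inflE : (infl 0 = 0) *
  ((forall u, infl (- u) = - infl u) * (forall u v, infl (u + v) = infl u + infl v)).
Proof.
by split=> //; split=> [u|u v]; congr pair.
Qed.
End TrivialExtension.

Ltac abelian := apply: infl_inj; rewrite !inflE; ring.

(** * Norm and involution of a C*-algebra *)

Section NormAlgebra.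
Variables (R : realType) (A : cstarAlgType R).
Implicit Types (a b c x y : A) (r : R).
Local Infix "**" := cmul (at level 40, left associativity).
Local Notation star := (@cstar R A).

Definition nrm a : R := complex.Re `|a|.

Lemma nrmE a : `|a| = (nrm a)%:C.
Proof. by rewrite /nrm RRe_real // normr_real. Qed.

Lemma nrm_ge0 a : 0 <= nrm a.
Proof. by rewrite -ler0c -nrmE. Qed.

Lemma ler_nrmD a b : nrm (a + b) <= nrm a + nrm b.
Proof. by rewrite -lecR rmorphD /= -!nrmE ler_normD. Qed.

Lemma nrmN a : nrm (- a) = nrm a.
Proof. by rewrite /nrm normrN. Qed.

Lemma nrmBC a b : nrm (a - b) = nrm (b - a).
Proof. by rewrite /nrm distrC. Qed.

Lemma ler_nrmB a b : nrm (a - b) <= nrm a + nrm b.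
Proof. by rewrite -(nrmN b) ler_nrmD. Qed.

Lemma nrmZ (k : R[i]) a : nrm (k *: a) = complex.Re `|k| * nrm a.
Proof.
apply: complexI; rewrite -nrmE normrZ nrmE -{1}(RRe_real (normr_real k)).
by rewrite -rmorphM.
Qed.

Lemma nrmZr r a : nrm (r%:C *: a) = `|r| * nrm a.
Proof. by rewrite nrmZ normc_def /= expr0n addr0 sqrtr_sqr. Qed.

Lemma nrm0_eq0 a : nrm a = 0 -> a = 0.
Proof. by move=> a0; apply/eqP; rewrite -normr_eq0 nrmE a0. Qed.

Lemma nrm0 : nrm (0 : A) = 0.
Proof. by rewrite /nrm normr0. Qed.

Lemma ler_nrmM a b : nrm (a ** b) <= nrm a * nrm b.
Proof. by rewrite -lecR rmorphM /= -!nrmE cnormM. Qed.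

Lemma nrm_starM a : nrm (star a ** a) = nrm a ^+ 2.
Proof. by apply: complexI; rewrite -nrmE cnorm_star nrmE rmorphXn. Qed.

(** The C*-identity gives |b|^2 = |b^* b| <= |b^*| |b|, that is |b| <= |b^*|;
apply this to b and to b^*. *)
Lemma nrm_star a : nrm (star a) = nrm a.
Proof.
have le_star b : nrm b <= nrm (star b).
  have [->|b0] := eqVneq (nrm b) 0; first exact: nrm_ge0.
  rewrite -(@ler_pM2r _ (nrm b)) -?expr2 ?lt_def ?b0 ?nrm_ge0 //.
  by rewrite -nrm_starM ler_nrmM.
by apply/eqP; rewrite eq_le le_star -{2}(cstarK a) le_star.
Qed.

Lemma starN a : star (- a) = - star a.
Proof. by rewrite -scaleN1r cstarZ rmorphN rmorph1 scaleN1r. Qed.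

Lemma starB a b : star (a - b) = star a - star b.
Proof. by rewrite cstarD starN. Qed.

Lemma starZr r a : star (r%:C *: a) = r%:C *: star a.
Proof. by rewrite cstarZ; congr (_ *: _); exact: (conjc_real r). Qed.

Lemma cmulNl a b : (- a) ** b = - (a ** b).
Proof. by rewrite -scaleN1r cmulZl scaleN1r. Qed.

Lemma cmulNr a b : a ** (- b) = - (a ** b).
Proof. by rewrite -scaleN1r cmulZr scaleN1r. Qed.

Lemma cmulBl a b c : (a - b) ** c = a ** c - b ** c.
Proof. by rewrite cmulDl cmulNl. Qed.

Lemma cmulBr a b c : a ** (b - c) = a ** b - a ** c.
Proof. by rewrite cmulDr cmulNr. Qed.

Lemma cmul0l a : 0 ** a = 0.
Proof. by rewrite -(scale0r a) cmulZl !scale0r. Qed.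

Lemma cmul0r a : a ** 0 = 0.
Proof. by rewrite -(scale0r a) cmulZr !scale0r. Qed.

End NormAlgebra.

(** * Sequences with an explicit Cauchy rate *)

Section Limits.
Variables (R : realType) (A : cstarAlgType R).
Implicit Types (a b c x y : A).

(** Bounds the distance of the n-th iterate below from its limit; 2 / n is the
true order of convergence when x = 1. *)
Definition rate n : R := 2 / n.+2%:R.

Lemma rate_lt (C e : R) : 0 < e -> exists n, forall m, (n <= m)%N -> C * rate m < e.
Proof.
move=> e0; exists (Num.trunc (2 * `|C| / e)) => m nm.
have rate0 : 0 <= rate m by rewrite divr_ge0.
apply: le_lt_trans (ler_wpM2r rate0 (ler_norm C)) _.
rewrite /rate mulrA ltr_pdivrMr ?ltr0Sn // (mulrC e) -ltr_pdivrMr // (mulrC _ 2).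
by apply: lt_le_trans (truncnS_gt _) _; rewrite ler_nat ltnS ltnW.
Qed.

Lemma le_rate_eq0 (C : R) a : (forall n, nrm a <= C * rate n) -> a = 0.
Proof.
move=> le_a; apply: nrm0_eq0; apply/eqP; rewrite eq_le nrm_ge0 andbT leNgt.
apply/negP => a0; have [n /(_ n (leqnn n))] := rate_lt C a0.
by rewrite ltNge le_a.
Qed.

(** Completeness of A, in a form that keeps the rate of convergence. *)
Lemma rate_limit (u : nat -> A) :
    (forall n k, nrm (u (n + k)%N - u n) <= rate n) ->
  exists X, forall n, nrm (u n - X) <= rate n.
Proof.
move=> du.
have /cauchy_cvgP/cvg_ex[X uX] : cauchy (u @ \oo).
  apply: cauchy_exP => e e0; have eE : e = (complex.Re e)%:C.
    by rewrite RRe_real // realE ltW.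
  have re0 : 0 < complex.Re e by rewrite -ltcR -eE.
  have [N Nrate] := rate_lt 1 re0; exists (u N).
  exists N => // m /= Nm; rewrite -ball_normE /= -normrN opprB nrmE eE ltcR.
  by rewrite -(subnKC Nm); apply: le_lt_trans (du _ _) _; rewrite -[rate N]mul1r Nrate.
exists X => n; apply/ler_addgt0Pr => e e0.
have eC0 : 0 < e%:C by rewrite ltcR.
have /cvgrPdist_lt/(_ _ eC0)[N _ /(_ (n + N)%N (leq_addl _ _))] := uX.
rewrite /= nrmE ltcR => lt_e.
rewrite -(subrK (u (n + N)%N) (u n)) -addrA.
apply: le_trans (ler_nrmD _ _) _; apply: lerD; first by rewrite nrmBC.
by rewrite nrmBC ltW.
Qed.

End Limits.

(** * Square roots of 1 - x *)

Section Sqrt.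
Variables (R : realType) (A : cstarAlgType R).
Implicit Types (a b c x y : A).
Local Infix "**" := cmul (at level 40, left associativity).
Local Notation star := (@cstar R A).

Lemma cmul_half_sq x y : x ** y = y ** x ->
  (x - y) ** (x + y) = x ** x - y ** y.
Proof.
by move=> xy; rewrite cmulDr !cmulBl xy addrA subrK.
Qed.

(** Iterates of X := (x + X^2) / 2, whose fixed points satisfy
(1 - X)^2 = 1 - x. *)
Fixpoint sqrt_iter x n : A :=
  if n is m.+1 then 2^-1%:C *: (x + sqrt_iter x m ** sqrt_iter x m) else 0.

Lemma sqrt_iterS x n :
  sqrt_iter x n.+1 = 2^-1%:C *: (x + sqrt_iter x n ** sqrt_iter x n).
Proof. by []. Qed.

(** The same iteration for x = 1 in the reals; it dominates [sqrt_iter] term by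
term and step by step. *)
Fixpoint real_iter n : R :=
  if n is m.+1 then 2^-1 * (1 + real_iter m * real_iter m) else 0.

(** With d = 1 - r the recursion reads d' = d - d^2 / 2; this map is increasing
on [0, 1] and sends 2 / (n + 2) below 2 / (n + 3). *)
Lemma real_iter_bounds n : 1 - rate R n <= real_iter n <= 1.
Proof.
elim: n => [|n /andP[IHl IHu]]; first by rewrite /rate divff // subrr lexx ler01.
rewrite /=; have n0 : 0 < n.+2%:R :> R by rewrite ltr0Sn.
have gn : rate R n * n.+2%:R = 2 by rewrite /rate divfK // gt_eqF.
have gn1 : rate R n.+1 * (n.+2%:R + 1) = 2.
  by rewrite natr1 /rate divfK // gt_eqF // ltr0Sn.
have g0 : 0 <= rate R n by rewrite divr_ge0.
have n2 : 2 <= n.+2%:R :> R by rewrite ler_nat.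
have g1 : rate R n <= 1 by rewrite -(ler_pM2r n0) gn mul1r.
set r := real_iter n in IHl IHu *; set g := rate R n in gn g0 g1 IHl *.
set g' := rate R n.+1 in gn1 *; set N : R := n.+2%:R in n0 n2 gn gn1 *.
have r0 : 0 <= r by lra.
have gg' : g - g * g / 2 <= g'.
  rewrite -(@ler_pM2r _ (N * N * (N + 1))); last first.
    by rewrite !mulr_gt0 //; lra.
  have -> : g' * (N * N * (N + 1)) = 2 * (N * N) by rewrite -gn1; ring.
  have -> : (g - g * g / 2) * (N * N * (N + 1)) =
      (g * N) * N * (N + 1) - (g * N) * (g * N) * (N + 1) / 2 by field.
  by rewrite gn; nra.
by apply/andP; split; nra.
Qed.

Lemma real_iter_step n :
  2^-1 * ((real_iter n.+1 - real_iter n) * (real_iter n.+1 + real_iter n)) =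
  real_iter n.+2 - real_iter n.+1.
Proof. by rewrite /=; field. Qed.

Lemma sqrt_iter_comm c x n : c ** x = x ** c ->
  c ** sqrt_iter x n = sqrt_iter x n ** c.
Proof.
move=> cx; elim: n => [|n IH] /=; first by rewrite cmul0l cmul0r.
by rewrite cmulZr cmulZl cmulDr cmulDl cx cmulA IH -!cmulA IH.
Qed.

Lemma sqrt_iter_star x n : star x = x -> star (sqrt_iter x n) = sqrt_iter x n.
Proof.
move=> sx; elim: n => [|n IH] /=; first by rewrite -(subrr 0) starB !subrr.
by rewrite starZr cstarD cstarM sx IH.
Qed.

Lemma nrm_half (a : A) : nrm (2^-1%:C *: a) = 2^-1 * nrm a.
Proof. by rewrite nrmZr ger0_norm // invr_ge0. Qed.

Lemma nrm_sqrt_iter x n : nrm x <= 1 -> nrm (sqrt_iter x n) <= real_iter n.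
Proof.
move=> x1; elim: n => [|n IH]; first by rewrite /= nrm0.
rewrite [sqrt_iter _ _]/= nrm_half [real_iter _]/= ler_pM2l ?invr_gt0 //.
apply: le_trans (ler_nrmD _ _) _; apply: lerD => //.
by apply: le_trans (ler_nrmM _ _) _; apply: ler_pM; rewrite ?nrm_ge0.
Qed.

(** The iterates commute, so consecutive differences satisfy
X'' - X' = (X' - X) (X' + X) / 2, and the same identity without norms holds for
[real_iter]. *)
Lemma sqrt_iter_step x n : nrm x <= 1 ->
  nrm (sqrt_iter x n.+1 - sqrt_iter x n) <= real_iter n.+1 - real_iter n.
Proof.
move=> x1; elim: n => [|n IH].
  by rewrite [sqrt_iter x 0]/= [real_iter 0]/= !subr0 nrm_sqrt_iter.
have -> : sqrt_iter x n.+2 - sqrt_iter x n.+1 = 2^-1%:C *: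
    (sqrt_iter x n.+1 ** sqrt_iter x n.+1 - sqrt_iter x n ** sqrt_iter x n).
  rewrite sqrt_iterS [X in _ - X]sqrt_iterS -scalerBr.
  by rewrite opprD addrACA subrr add0r.
rewrite -real_iter_step nrm_half ler_pM2l ?invr_gt0 //.
have cxx : sqrt_iter x n.+1 ** sqrt_iter x n = sqrt_iter x n ** sqrt_iter x n.+1.
  by apply: sqrt_iter_comm; apply/esym/sqrt_iter_comm.
rewrite -cmul_half_sq //.
apply: le_trans (ler_nrmM _ _) _; apply: ler_pM => //; rewrite ?nrm_ge0 //.
apply: le_trans (ler_nrmD _ _) _.
by apply: lerD; apply: nrm_sqrt_iter.
Qed.

Lemma sqrt_iter_cauchy x n k : nrm x <= 1 ->
  nrm (sqrt_iter x (n + k)%N - sqrt_iter x n) <= rate R n.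
Proof.
move=> x1; apply: (@le_trans _ _ (real_iter (n + k)%N - real_iter n)).
  elim: k => [|k IH]; first by rewrite addn0 !subrr nrm0.
  rewrite addnS -(subrK (sqrt_iter x (n + k)%N) (sqrt_iter x (n + k).+1)) -addrA.
  apply: le_trans (ler_nrmD _ _) _.
  by have := lerD (sqrt_iter_step (n + k)%N x1) IH; rewrite addrA subrK.
by have := real_iter_bounds n; have := real_iter_bounds (n + k)%N; lra.
Qed.

(** In unital notation 1 - x = (1 - X)^2 with |X| <= 1.  Being a limit of
polynomials in x, X commutes with whatever commutes with x. *)
Lemma one_sub_sqrt x : nrm x <= 1 ->
  exists X, [/\ X + X - X ** X = x, nrm X <= 1,
    forall c, c ** x = x ** c -> c ** X = X ** c & star x = x -> star X = X].
Proof.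
move=> x1; have [X dX] := rate_limit (fun n k => sqrt_iter_cauchy n k x1).
have Xn1 n : nrm (sqrt_iter x n) <= 1.
  by apply: le_trans (nrm_sqrt_iter n x1) _; have /andP[] := real_iter_bounds n.
have X1 : nrm X <= 1.
  apply/ler_addgt0Pr => e e0; have [n /(_ n (leqnn n))] := rate_lt 1 e0.
  rewrite mul1r => ratee; rewrite -(subrK (sqrt_iter x n) X).
  apply: le_trans (ler_nrmD _ _) _; rewrite addrC lerD // nrmBC.
  by apply: le_trans (dX n) (ltW ratee).
have rateS n : rate R n.+1 <= rate R n.
  by rewrite /rate ler_pM2l // lef_pV2 ?posrE ?ltr0Sn // ler_nat.
exists X; split=> //.
- apply/eqP; rewrite -subr_eq0; apply/eqP/(@le_rate_eq0 _ _ 4) => n.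
  set S := sqrt_iter x n; set S' := sqrt_iter x n.+1.
  have xE : x = S' + S' - S ** S.
    rewrite /S' /= -/S -scalerDl -rmorphD /= (_ : 2^-1 + 2^-1 = 1 :> R) ?scale1r ?addrK //.
    by field.
  have -> : X + X - X ** X - x = (X - S') + (X - S') + ((S - X) ** S + X ** (S - X)).
    by rewrite xE cmulBl cmulBr; abelian.
  apply: le_trans (ler_nrmD _ _) _.
  apply: (@le_trans _ _ ((rate R n + rate R n) + (rate R n + rate R n))); last by lra.
  have XS' : nrm (X - S') <= rate R n by rewrite nrmBC; apply: le_trans (dX _) _.
  apply: lerD; apply: le_trans (ler_nrmD _ _) _; apply: lerD => //.
    apply: le_trans (ler_nrmM _ _) _; rewrite -[leRHS]mulr1.
    by apply: ler_pM; rewrite ?nrm_ge0 ?dX ?Xn1.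
  apply: le_trans (ler_nrmM _ _) _; rewrite -[leRHS]mul1r.
  by apply: ler_pM; rewrite ?nrm_ge0 ?dX.
- move=> c cx; apply/eqP; rewrite -subr_eq0; apply/eqP.
  apply: (@le_rate_eq0 _ _ (nrm c + nrm c)) => n.
  have -> : c ** X - X ** c =
      (sqrt_iter x n - X) ** c - c ** (sqrt_iter x n - X).
    by rewrite cmulBl cmulBr sqrt_iter_comm //; abelian.
  apply: le_trans (ler_nrmB _ _) _; rewrite mulrDl.
  apply: lerD; apply: le_trans (ler_nrmM _ _) _.
    by rewrite mulrC ler_wpM2l ?nrm_ge0 ?dX.
  by rewrite ler_wpM2l ?nrm_ge0 ?dX.
- move=> sx; apply/eqP; rewrite -subr_eq0; apply/eqP.
  apply: (@le_rate_eq0 _ _ 2) => n.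
  rewrite -(subrK (sqrt_iter x n) (star X)) -addrA mulrDl mul1r.
  apply: le_trans (ler_nrmD _ _) _; apply: lerD; last exact: dX.
  by rewrite -(sqrt_iter_star n sx) -starB nrm_star nrmBC dX.
Qed.

End Sqrt.

(** * The positive part of g^2 - 1 *)

Section PositiveExcess.
Variables (R : realType) (A : cstarAlgType R).
Implicit Types (a b c e g p t x y : A).
Local Infix "**" := cmul (at level 40, left associativity).
Local Notation star := (@cstar R A).

Let cmulE := (@cmulBl R A, @cmulBr R A, @cmulDl R A, @cmulDr R A).

(** |p|^2 = |p p| <= |p|; in a unital algebra one would test p against 1. *)
Lemma sa_contraction p : star p = p ->
  (forall b, nrm (p ** b) <= nrm b) -> nrm p <= 1.
Proof.
move=> sp p1; have [->|p0] := eqVneq (nrm p) 0; first exact: ler01.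
rewrite -(@ler_pM2r _ (nrm p)) ?lt_def ?p0 ?nrm_ge0 //.
by rewrite mul1r -expr2 -nrm_starM sp p1.
Qed.

(** Expands (w + k z)^* (w + k z) for k = i or k = - i. *)
Lemma nrm_addi w z b (k : R[i]) : Num.conj k = - k -> k * k = -1 ->
    star w ** z = star z ** w -> star w ** w + star z ** z = star b ** b ->
  nrm (w + k *: z) = nrm b.
Proof.
move=> kJ kk wz wwzz; apply/eqP; rewrite -(@eqrXn2 _ 2) ?nrm_ge0 //; apply/eqP.
rewrite -!nrm_starM -wwzz cstarD cstarZ kJ !cmulE !(cmulZl, cmulZr) scalerA wz.
by rewrite mulNr kk opprK scale1r scaleNr; congr nrm; abelian.
Qed.

(** In unital notation p^2 + (1 - t)^2 = 1, so (1 - t) + i p and (1 - t) - i p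
are unitary and p is, up to the factor i, half their difference. *)
Lemma le1_of_sum_squares p t : star p = p -> star t = t -> p ** t = t ** p ->
  p ** p = t + t - t ** t -> nrm p <= 1.
Proof.
move=> sp st pt pp; apply: sa_contraction => // b.
set w := b - t ** b; set z := p ** b.
have wz : star w ** z = star z ** w.
  rewrite /w /z starB !cstarM sp st !cmulE !cmulA; congr (_ - _).
  by rewrite -(cmulA (star b)) -pt cmulA.
have wwzz : star w ** w + star z ** z = star b ** b.
  rewrite /w /z starB !cstarM sp st !cmulE !cmulA.
  by rewrite -(cmulA _ p p) pp !cmulE !cmulA; abelian.
have iJ : Num.conj 'i%R = - 'i%R :> R[i] by rewrite conjCi.
have ii : 'i%R * 'i%R = -1 :> R[i] by rewrite -expr2 sqrCi.
have NiJ : Num.conj (- 'i%R) = - - 'i%R :> R[i] by rewrite rmorphN /= iJ.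
have NiNi : - 'i%R * - 'i%R = -1 :> R[i] by rewrite mulrNN.
have u1 := nrm_addi iJ ii wz wwzz; have u2 := nrm_addi NiJ NiNi wz wwzz.
have iz : nrm ('i%R *: z) = nrm z by rewrite nrmZ normCi mul1r.
have := ler_nrmB (w + 'i%R *: z) (w + (- 'i%R) *: z); rewrite u1 u2.
rewrite scaleNr (_ : _ - _ = 'i%R *: z + 'i%R *: z); last by abelian.
by rewrite -scalerDl -mulr2n -mulr_natl -scalerA nrmZ normr_nat iz /=; lra.
Qed.

Lemma mulr4n_eq0 a : a *+ 4 = 0 -> a = 0.
Proof. by rewrite -scaler_nat => /eqP; rewrite scaler_eq0 pnatr_eq0 => /eqP. Qed.

(** Algebraic description of e = (t - 1)_+: the third condition says
(t - 1) e = e^2, and t - 2 e = 1 - |1 - t|. *)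
Definition excess t e := [/\ star t = t, star e = e,
  t ** e = e ** e + e & nrm (t - (e + e)) <= 1].

(** With t = 2 x and x = 1 - (1 - X)^2, the element p = sqrt 2 (g - g X)
satisfies p^2 = 2 t - t^2 = 1 - (1 - t)^2; the square root D of this one has
1 - D = |1 - t|. *)
Lemma excess_exists g : star g = g -> nrm g ^+ 2 <= 2 ->
  exists e, excess (g ** g) e.
Proof.
move=> sg g2; set t := g ** g; have tE : g ** g = t by []; clearbody t; set x := 2^-1%:C *: t.
have xx : x + x = t.
  by rewrite /x -scalerDl -rmorphD /= (_ : 2^-1 + 2^-1 = 1 :> R) ?scale1r //; field.
have st : star t = t by rewrite -tE cstarM sg.
have gt : g ** t = t ** g by rewrite -tE cmulA.
have x1 : nrm x <= 1.
  by rewrite nrm_half -tE -{1}sg nrm_starM; lra.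
have [X [Xx _ Xcomm Xstar]] := one_sub_sqrt x1.
have sX : star X = X by apply: Xstar; rewrite starZr st.
have gX : g ** X = X ** g by apply: Xcomm; rewrite cmulZl cmulZr gt.
have tX : t ** X = X ** t by apply: Xcomm; rewrite cmulZl cmulZr.
set q := g - g ** X; set s := (Num.sqrt 2)%:C : R[i].
have qq : q ** q + q ** q = t + t - t ** t.
  have -> : q ** q = t - t ** x.
    rewrite /q !cmulE tE -Xx !cmulE !cmulA tE.
    rewrite -(cmulA g X g) -gX cmulA tE.
    by rewrite -(cmulA t X X); abelian.
  by have -> : t ** t = t ** x + t ** x; [rewrite -cmulDr xx | abelian].
set p := s *: q.
have pp : p ** p = t + t - t ** t.
  rewrite cmulZl cmulZr scalerA -qq /s -rmorphM /= -expr2 sqr_sqrtr //.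
  by rewrite (_ : 2%:C = 2) ?rmorph_nat // scaler_nat mulr2n.
have sq : star q = q by rewrite /q starB cstarM sX sg gX.
have p1 : nrm p <= 1.
  apply: (@le1_of_sum_squares _ t) => //; first by rewrite starZr sq.
  rewrite cmulZl cmulZr; congr (_ *: _); rewrite /q !cmulE gt.
  by congr (_ - _); rewrite -cmulA -tX !cmulA gt.
have y1 : nrm (p ** p) <= 1.
  by apply: le_trans (ler_nrmM _ _) _; rewrite mulr_ile1 ?nrm_ge0.
have [D [DD D1 Dcomm Dstar]] := one_sub_sqrt y1.
have sD : star D = D.
  by apply: Dstar; rewrite pp starB cstarD cstarM st.
set e := 2^-1%:C *: (t - D).
have ee : e + e = t - D.
  by rewrite /e -scalerDl -rmorphD /= (_ : 2^-1 + 2^-1 = 1 :> R) ?scale1r //; field.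
have te : t ** e = e ** t.
  by rewrite /e cmulZr cmulZl !cmulE (Dcomm t) // pp !cmulE cmulA.
exists e; split=> //; first by rewrite starZr starB st sD.
- apply/eqP; rewrite -subr_eq0; apply/eqP/mulr4n_eq0.
  have DE : D = t - (e + e) by rewrite ee opprB addrC subrK.
  move: DD; rewrite pp {1 2 3 4}DE !cmulE -te => DD.
  have := congr1 (fun z => z - (t + t - t ** t)) DD; rewrite subrr => <-.
  by rewrite !mulrS mulr0n; abelian.
- by rewrite ee opprB addrC subrK.
Qed.

End PositiveExcess.

(** * Finite-dimensional Hilbert spaces as real inner product spaces *)

Section RealDot.
Variables (R : realType) (H : fdHilbert R).
Implicit Types (x y z v : H) (r : R).

Definition rdot x y : R := complex.Re (hdot H x y).

Lemma rdotC x y : rdot x y = rdot y x.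
Proof.
by rewrite /rdot (hermC (hdot H)) /= expr0 mul1r; case: (hdot H y x).
Qed.

Lemma rdotDl x y z : rdot (x + y) z = rdot x z + rdot y z.
Proof. by rewrite /rdot linearDl raddfD. Qed.

Lemma rdotNl x y : rdot (- x) y = - rdot x y.
Proof. by rewrite /rdot linearNl raddfN. Qed.

Lemma rdotZl r x y : rdot (r%:C *: x) y = r * rdot x y.
Proof.
rewrite /rdot linearZl_LR /=; case: (hdot H x y) => a b.
by simpc.
Qed.

Lemma rdotBl x y z : rdot (x - y) z = rdot x z - rdot y z.
Proof. by rewrite rdotDl rdotNl. Qed.

Lemma rdotDr x y z : rdot z (x + y) = rdot z x + rdot z y.
Proof. by rewrite !(rdotC z) rdotDl. Qed.

Lemma rdotNr x y : rdot y (- x) = - rdot y x.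
Proof. by rewrite !(rdotC y) rdotNl. Qed.

Lemma rdotBr x y z : rdot z (x - y) = rdot z x - rdot z y.
Proof. by rewrite !(rdotC z) rdotBl. Qed.

Lemma rdotZr r x y : rdot y (r%:C *: x) = r * rdot y x.
Proof. by rewrite !(rdotC y) rdotZl. Qed.

Lemma rdot0l x : rdot 0 x = 0.
Proof. by rewrite -(subrr 0) rdotBl subrr. Qed.

Lemma rdot0r x : rdot x 0 = 0.
Proof. by rewrite rdotC rdot0l. Qed.

Definition rdotE := (rdotDl, rdotBl, rdotNl, rdotZl, rdot0l,
                     rdotDr, rdotBr, rdotNr, rdotZr, rdot0r).

Lemma rdot_ge0 x : 0 <= rdot x x.
Proof. by have := dnorm_ge0 (hdot H) x; rewrite lecE => /andP[]. Qed.

Lemma rdot_eq0 x : rdot x x <= 0 -> x = 0.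
Proof.
move=> x0; apply/eqP; rewrite -(dnorm_eq0 (hdot H)).
have := dnorm_ge0 (hdot H) x; have := rdot_ge0 x.
rewrite le_eqVlt ltNge x0 orbF /rdot => /eqP re0.
by rewrite lecE => /andP[/eqP im0 _]; rewrite eq_complex -re0 im0 /= !eqxx.
Qed.

Lemma rdot_CauchySchwarz x y : rdot x y ^+ 2 <= rdot x x * rdot y y.
Proof.
have [y0|y0] := leP (rdot y y) 0.
  by rewrite (rdot_eq0 y0) !rdotE mulr0 expr0n.
have := rdot_ge0 ((rdot y y)%:C *: x - (rdot x y)%:C *: y).
rewrite !rdotE (rdotC y x); set a := rdot x x; set b := rdot x y.
set c := rdot y y in y0 *; move=> h.
by rewrite -(ler_pM2l y0); nra.
Qed.

(** T^3 >= 0 implies T >= 0: the kernel and the range of a self-adjoint T meet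
trivially, so in finite dimension T x = T^2 u for some u, and then
<T x, x> = <T^3 u, u>. *)
Lemma sa_ge0_of_cube (T : 'End(H)) :
    (forall x y, rdot (T x) y = rdot x (T y)) ->
    (forall x, 0 <= rdot (T (T x)) (T x)) ->
  forall x, 0 <= rdot (T x) x.
Proof.
move=> saT T3 x.
have [u Tu] : exists u, T x = T (T u).
  have : (T @: limg T == limg T)%VS.
    rewrite eqEdim; apply/andP; split; first exact: limgS (subvf _).
    rewrite -(limg_ker_dim T (limg T)) (_ : (_ :&: _)%VS = 0%VS) ?dimv0 //.
    apply/eqP; rewrite -subv0; apply/subvP => y; rewrite memv_cap => /andP[].
    move=> /memv_imgP[z _ ->]; rewrite memv_ker memv0 => /eqP TTz.
    by apply/eqP/rdot_eq0; rewrite saT TTz rdot0r.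
  move=> /eqP imT; have : T x \in (T @: limg T)%VS by rewrite imT memv_img ?memvf.
  by move=> /memv_imgP[_ /memv_imgP[u _ ->] ->]; exists u.
by rewrite Tu saT Tu rdotC.
Qed.

End RealDot.

(** * Representations and the image of the excess *)

Section Representations.
Variables (R : realType) (A : cstarAlgType R).
Implicit Types (a b c e t x y : A) (pi : fdrep A).
Local Infix "**" := cmul (at level 40, left associativity).
Local Notation star := (@cstar R A).

Lemma repMv pi a b (v : rep_space pi) : pi (a ** b) v = pi a (pi b v).
Proof. by rewrite repM comp_lfunE. Qed.

Lemma repDv pi a b (v : rep_space pi) : pi (a + b) v = pi a v + pi b v.
Proof. by rewrite linearD add_lfunE. Qed.

Lemma repBv pi a b (v : rep_space pi) : pi (a - b) v = pi a v - pi b v.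
Proof. by rewrite linearB add_lfunE opp_lfunE. Qed.

Lemma repZv pi (k : R[i]) a (v : rep_space pi) : pi (k *: a) v = k *: pi a v.
Proof. by rewrite linearZ scale_lfunE. Qed.

Lemma rdot_rep pi a (x y : rep_space pi) :
  rdot (pi a x) y = rdot x (pi (star a) y).
Proof. by rewrite /rdot rep_star. Qed.

(** Bounds the operator norm of pi(a) by r >= 0, without square roots. *)
Definition bounded_by pi a (r : R) :=
  forall v : rep_space pi, rdot (pi a v) (pi a v) <= r ^+ 2 * rdot v v.

(** For |b| <= 1 write 1 - b^* b = (1 - X)^2; then
|v|^2 - |pi(b) v|^2 = |v - pi(X) v|^2. *)
Lemma rep_contraction pi a : bounded_by pi a (nrm a).
Proof.
have contr b (v : rep_space pi) : nrm b <= 1 -> rdot (pi b v) (pi b v) <= rdot v v.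
  move=> b1; have bb1 : nrm (star b ** b) <= 1.
    by rewrite nrm_starM expr_le1 ?nrm_ge0.
  have [X [Xb _ _ Xstar]] := one_sub_sqrt bb1.
  have sX : star X = X by apply: Xstar; rewrite cstarM cstarK.
  rewrite rdot_rep -repMv -Xb repBv repDv repMv !rdotE.
  have := rdot_ge0 (v - pi X v); rewrite !rdotE (rdotC (pi X v) v).
  by rewrite [rdot (pi X v) (pi X v)]rdot_rep sX; lra.
move=> v; have [a0|a0] := eqVneq (nrm a) 0.
  by rewrite (nrm0_eq0 a0) linear0 lfunE /= rdot0l nrm0 expr0n mul0r.
have a_gt0 : 0 < nrm a by rewrite lt_def a0 nrm_ge0.
have := contr ((nrm a)^-1%:C *: a) v.
rewrite nrmZr ger0_norm ?invr_ge0 ?nrm_ge0 // mulVf // => /(_ (lexx _)).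
rewrite repZv !rdotE mulrA -invfM -expr2.
by rewrite mulrC ler_pdivrMr ?exprn_gt0 // mulrC.
Qed.

Section ExcessImage.
Variables (pi : fdrep A) (t e : A).
Hypothesis te_excess : excess t e.
Local Notation T := (pi t).
Local Notation E := (pi e).
Implicit Types v w : rep_space pi.

Let saT v w : rdot (T v) w = rdot v (T w).
Proof. case: te_excess => star_t _ _ _; by rewrite rdot_rep star_t. Qed.

Let saE v w : rdot (E v) w = rdot v (E w).
Proof. case: te_excess => _ star_e _ _; by rewrite rdot_rep star_e. Qed.

Let te_comm : t ** e = e ** t.
Proof.
case: te_excess => st se te _.
by rewrite te -[in RHS]st -[in RHS]se -cstarM te cstarD cstarM se.
Qed.

Let TE v : T (E v) = E (E v) + E v.
Proof. case: te_excess => _ _ teE _; by rewrite -!repMv teE repDv. Qed.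

Let ET v : E (T v) = E (E v) + E v.
Proof. by rewrite -TE -!repMv te_comm. Qed.

Let cut1v v : rdot (T v - (E v + E v)) (T v - (E v + E v)) <= rdot v v.
Proof.
have [_ _ _ cut1] := te_excess.
rewrite -!repDv -repBv; apply: le_trans (@rep_contraction pi (t - (e + e)) v) _.
by rewrite ler_piMl ?rdot_ge0 // expr_le1 ?nrm_ge0.
Qed.

(* On the range of E one has T = E + 1, so the contraction T - 2 E acts there as
   1 - E. *)
Let cube v : rdot (E (E v)) (E (E v)) <= 2 * rdot (E (E v)) (E v).
Proof.
have := cut1v (E v); rewrite TE !rdotE (rdotC (E v) (E (E v))); lra.
Qed.

Lemma excess_ge0 v : 0 <= rdot (E v) v.
Proof.
apply: sa_ge0_of_cube => // w.
by have := cube w; have := rdot_ge0 (E (E w)); lra.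
Qed.

(** The operator S = 1 - T + E is the negative part of T - 1: it satisfies
E S = 0, and on its range T coincides with the contraction T - 2 E, so that
S^3 >= 0. *)
Lemma le_one_plus_excess v : rdot (T v) v <= rdot v v + rdot (E v) v.
Proof.
pose S : 'End(rep_space pi) := (\1 - T + E)%VF.
have SE w : S w = w - T w + E w by rewrite !lfunE /= !lfunE /= !lfunE.
have ES w : E (S w) = 0 by rewrite SE linearD linearB /= ET; abelian.
have := @sa_ge0_of_cube _ _ S _ _ v; rewrite SE !rdotE => posS.
suff : 0 <= rdot v v - rdot (T v) v + rdot (E v) v by lra.
apply: posS => [x y|x]; first by rewrite !SE !rdotE saT saE.
have := cut1v (S x); rewrite (SE (S x)) ES !addr0 subr0.
have := rdot_ge0 (S x - T (S x)).
by rewrite !rdotE (rdotC (S x) (T (S x))); lra.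
Qed.

(** For w = E v one has <T w, w> = <E w, w> + |w|^2, so T <= 1 forces
<E w, w> <= 0 and then E w = 0. *)
Lemma excess_eq0 : (forall v, rdot (T v) v <= rdot v v) -> E = 0.
Proof.
move=> T1; apply/lfunP => v; rewrite lfunE /=.
have := T1 (E v); rewrite TE rdotDl => T1E.
have EE : E (E v) = 0 by apply: rdot_eq0; have := cube v; lra.
by apply: rdot_eq0; rewrite saE EE rdot0r.
Qed.

(** If t <= k then (t - 1)_+ <= k - 1.  Writing 1 - t / k = (1 - X)^2, positivity
of E at v - X v says E (1 - t / k) >= 0. *)
Lemma excess_le (k : R) v : 0 < k -> nrm t <= k ->
  rdot (E v) (E v) <= (k - 1) * rdot (E v) v.
Proof.
move=> k0 tk; set x := k^-1%:C *: t.
have x1 : nrm x <= 1.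
  have kV0 : 0 <= k^-1 by rewrite invr_ge0 ltW.
  by rewrite nrmZr ger0_norm // ler_pdivrMl // mulr1.
have [X [Xx _ Xcomm Xstar]] := one_sub_sqrt x1.
have sX : star X = X by apply: Xstar; rewrite starZr; case: te_excess => ->.
have eX : e ** X = X ** e by apply: Xcomm; rewrite cmulZl cmulZr te_comm.
have EX w : E (pi X w) = pi X (E w) by rewrite -!repMv eX.
have saX w w' : rdot (pi X w) w' = rdot w (pi X w') by rewrite rdot_rep sX.
have := excess_ge0 (v - pi X v); rewrite linearB /= EX !rdotE !saX.
have : rdot (E v) (pi X v + pi X v - pi X (pi X v)) = k^-1 * rdot (E v) (T v).
  by rewrite -repMv -repDv -repBv Xx repZv rdotZr.
rewrite !rdotE -(saT (E v) v) TE rdotDl (saE (E v) v) => XX le0.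
have : rdot (E v) (E v) + rdot (E v) v <= k * rdot (E v) v; last by lra.
by rewrite -ler_pdivrMl //; lra.
Qed.

Section SmallExcess.
Hypothesis Esq : forall v, rdot (E v) (E v) <= rdot (E v) v.

Lemma one_sub_excess_contraction v : rdot (v - E v) (v - E v) <= rdot v v.
Proof.
have := Esq v; have := excess_ge0 v.
by rewrite !rdotE (rdotC v (E v)); lra.
Qed.

(** This is t (1 - e)^2 <= 1: where t = 1 + e it reads (1 + e) (1 - e)^2 <= 1,
which holds for 0 <= e <= 1, and elsewhere e = 0 and t <= 1. *)
Lemma excess_weight_le1 v : rdot (T (v - E v)) (v - E v) <= rdot v v.
Proof.
have T_le := le_one_plus_excess v; have E0 := excess_ge0 v.
have TvEv : rdot (T v) (E v) = rdot (E v) (E v) + rdot (E v) v.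
  by rewrite saT TE rdotDr (rdotC v (E (E v))) (saE (E v)) (rdotC v).
have := rdot_ge0 (E v - E (E v)); have := Esq (E v).
rewrite linearB /= TE !rdotE TvEv (rdotC (E v) (E (E v))).
by rewrite (saE (E v) v); lra.
Qed.

End SmallExcess.
End ExcessImage.
End Representations.

(** * Subrepresentations *)

Section Subrepresentation.
Variables (R : realType) (A : cstarAlgType R) (pi : fdrep A).
Variable V : {vspace rep_space pi}.
Hypothesis stableV : forall a : A, (pi a @: V <= V)%VS.
Local Notation H := (rep_space pi).

Let vsval_inj : injective (@vsval _ _ V) := val_inj.

Definition subdot (x y : subvs_of V) : R[i] := hdot H (vsval x) (vsval y).

Lemma subdot_bilinear : bilinear_for *%R (Num.conj \; *%R) subdot.
Proof.
by split=> x k y z; rewrite /subdot linearP //= linearDl linearZl_LR.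
Qed.

HB.instance Definition _ := bilinear_isBilinear.Build R[i] (subvs_of V)
  (subvs_of V) R[i] *%R (Num.conj \; *%R) subdot subdot_bilinear.

Lemma subdot_hermitian x y :
  subdot x y = (-1) ^+ false * Num.conj (subdot y x).
Proof. exact: hermC. Qed.

HB.instance Definition _ := isHermitianSesquilinear.Build R[i] (subvs_of V)
  false Num.conj subdot subdot_hermitian.

Lemma subdot_gt0 x : x != 0 -> 0 < subdot x x.
Proof.
by move=> x0; rewrite /subdot dnorm_gt0; apply: contra x0 => /eqP x0; apply/eqP/vsval_inj.
Qed.

HB.instance Definition _ := isDotProduct.Build R[i] (subvs_of V)
  subdot subdot_gt0.

Definition sub_space : fdHilbert R := FdHilbert (subdot : {dot subvs_of V for Num.conj}).

Definition sub_map (a : A) : 'End(sub_space) :=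
  (linfun (vsproj V) \o pi a \o linfun vsval)%VF.

Lemma sub_mapE a x : vsval (sub_map a x) = pi a (vsval x).
Proof.
rewrite /sub_map !comp_lfunE !lfunE /= vsprojK //.
by apply: (subvP (stableV a)); rewrite memv_img // subvsP.
Qed.

Lemma sub_map_linear : linear sub_map.
Proof.
move=> k a b; apply/lfunP => x; apply: vsval_inj.
rewrite add_lfunE scale_lfunE sub_mapE linearP add_lfunE scale_lfunE.
by rewrite linearP /= !sub_mapE.
Qed.

HB.instance Definition _ := GRing.isLinear.Build R[i] A 'End(sub_space) *:%R
  sub_map sub_map_linear.

Lemma sub_mapM a b : sub_map (cmul a b) = (sub_map a \o sub_map b)%VF.
Proof.
by apply/lfunP => x; apply: vsval_inj; rewrite comp_lfunE !sub_mapE repMv.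
Qed.

Lemma sub_map_star a x y :
  hdot sub_space (sub_map a x) y = hdot sub_space x (sub_map (cstar a) y).
Proof.
by rewrite /= /subdot !sub_mapE rep_star.
Qed.

Definition subrep : fdrep A := @FdRep R A sub_space sub_map sub_mapM sub_map_star.

Lemma subrep_bounded a r v : bounded_by subrep a r -> v \in V ->
  rdot (pi a v) (pi a v) <= r ^+ 2 * rdot v v.
Proof.
move=> br vV; have := br (vsproj V v).
by rewrite /rdot /= /subdot !sub_mapE vsprojK.
Qed.

Lemma subrep_dim : rep_dim subrep = \dim V.
Proof. by rewrite /rep_dim dimvf. Qed.

End Subrepresentation.

(** * Irreducible representations and the operator norm *)

Section Irreducible.
Variables (R : realType) (A : cstarAlgType R).
Implicit Types (a : A) (pi : fdrep A).

(** Induction on the dimension: a reducible representation is the orthogonal sum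
of the restrictions to an invariant subspace and to its orthogonal complement,
which is again invariant because the representation preserves adjoints. *)
Lemma bounded_by_irreducible a r :
    (forall pi, irreducible pi -> bounded_by pi a r) ->
  forall pi, bounded_by pi a r.
Proof.
move=> irr_r pi; move: {2}(rep_dim pi).+1 (ltnSn (rep_dim pi)) => n.
elim: n pi => // n IH pi; rewrite ltnS => dim_le.
have [[dim0|]|] := pselect (rep_dim pi = 0%N \/ irreducible pi); last 2 first.
- exact: irr_r.
- move=> /not_orP[dimN0 /not_andP[//|/existsNP[V /not_implyP[stabV]]]].
  move=> /not_orP[VN0 VNf] v.
  pose W := orthov (hdot (rep_space pi)) V.
  have orthVW x y : x \in V -> y \in W -> hdot _ y x = 0.
    by move=> xV /mem_orthovP; apply.
  have stabW b : (pi b @: W <= W)%VS.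
    apply/subvP => _ /memv_imgP[w wW ->]; apply/mem_orthovP => x xV.
    apply: etrans (rep_star b w x) _; apply: orthVW => //.
    by apply: (subvP (stabV (cstar b))); rewrite memv_img.
  have dimV : (rep_dim (subrep stabV) < n)%N.
    rewrite subrep_dim; apply: leq_trans dim_le.
    rewrite /rep_dim ltnNge; apply/negP => dimfV.
    by apply: VNf; apply/eqP; rewrite eqEdim subvf.
  have dimW : (rep_dim (subrep stabW) < n)%N.
    rewrite subrep_dim; apply: leq_trans dim_le.
    rewrite /rep_dim ltnNge; apply/negP => dimfW; apply: VN0; apply/eqP.
    rewrite -subv0; apply/subvP => x xV; rewrite memv0 -(dnorm_eq0 (hdot _)).
    apply/eqP/orthVW => //; have /eqP -> : W == fullv by rewrite eqEdim subvf.
    exact: memvf.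
  have [x xV [y [-> xy yV]]] := orthogonal_split (hdot _) (vbasis V) v.
  rewrite (span_basis (vbasisP V)) in xV.
  have yW : y \in W.
    apply/mem_orthovP => z zV; move: yV; rewrite orthogonalE => /orthovP; apply.
      by rewrite memv_span // mem_head.
    by rewrite (span_basis (vbasisP V)).
  have xy0 : rdot x y = 0 by rewrite /rdot xy.
  have pixy0 : rdot (pi a x) (pi a y) = 0.
    rewrite rdotC /rdot orthVW //.
      by apply: (subvP (stabV a)); rewrite memv_img.
    by apply: (subvP (stabW a)); rewrite memv_img.
  have := subrep_bounded (IH _ dimV) xV; have := subrep_bounded (IH _ dimW) yW.
  rewrite linearD !rdotE (rdotC y x) (rdotC (pi a y) (pi a x)) xy0 pixy0.
  by lra.
- move=> v; have -> : v = 0; last by rewrite linear0 !rdotE mulr0.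
  apply/eqP; rewrite -memv0; have := memvf v.
  by have /eqP -> : fullv == 0%VS :> {vspace rep_space pi} by rewrite -dimv_eq0; apply/eqP.
Qed.

End Irreducible.

Section OperatorNorm.
Variables (R : realType) (A : cstarAlgType R).
Implicit Types (a : A) (pi : fdrep A) (r : R).

Lemma hnormE (H : fdHilbert R) (x : H) : hnorm x = Num.sqrt (rdot x x).
Proof. by []. Qed.

Lemma bounded_by_le pi a r s : 0 <= r <= s -> bounded_by pi a r -> bounded_by pi a s.
Proof.
move=> /andP[r0 rs] br v; apply: le_trans (br v) _.
by apply: ler_wpM2r; [exact: rdot_ge0 | rewrite ler_pXn2r ?nnegrE //; lra].
Qed.

Lemma hnorm_bounded pi a r (v : rep_space pi) : 0 <= r -> bounded_by pi a r ->
  hnorm v <= 1 -> hnorm (pi a v) <= r.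
Proof.
move=> r0 br; rewrite !hnormE => v1.
rewrite -[leRHS]ger0_norm // -sqrtr_sqr; apply: ler_wsqrtr.
apply: le_trans (br v) _; rewrite ler_piMr ?sqr_ge0 //.
by rewrite -(@ler_sqrt _ _ 1) ?sqrtr1.
Qed.

Lemma opnorm_le pi a r : 0 <= r -> bounded_by pi a r -> opnorm (pi a) <= r.
Proof.
move=> r0 br; apply: ge_sup => [|_ [v v1 <-]]; last exact: hnorm_bounded.
by exists (hnorm (pi a 0)), 0; rewrite //= hnormE rdot0l sqrtr0.
Qed.

Lemma hnorm_le_opnorm pi a (v : rep_space pi) :
  hnorm v <= 1 -> hnorm (pi a v) <= opnorm (pi a).
Proof.
move=> v1; apply: ub_le_sup; last by exists v.
exists (nrm a) => _ [x x1 <-]; apply: hnorm_bounded x1; first exact: nrm_ge0.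
exact: rep_contraction.
Qed.

Lemma opnorm_ge0 pi a : 0 <= opnorm (pi a).
Proof.
apply: le_trans (sqrtr_ge0 _) (@hnorm_le_opnorm pi a 0 _).
by rewrite hnormE rdot0l sqrtr0.
Qed.

Lemma opnorm_bounded pi a : bounded_by pi a (opnorm (pi a)).
Proof.
move=> v; have [v0|v0] := leP (rdot v v) 0.
  by rewrite (rdot_eq0 v0) linear0 !rdot0l mulr0.
set N := Num.sqrt (rdot v v).
have N0 : 0 < N by rewrite sqrtr_gt0.
have NN : N ^+ 2 = rdot v v by rewrite sqr_sqrtr // ltW.
rewrite -NN -exprMn -ler_sqrt ?sqr_ge0 // sqrtr_sqr ger0_norm; last first.
  by rewrite mulr_ge0 ?opnorm_ge0 // ltW.
have NV0 : 0 <= N^-1 by rewrite invr_ge0 ltW.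
have hZ (x : rep_space pi) : hnorm (N^-1%:C *: x) = N^-1 * hnorm x.
  by rewrite !hnormE !rdotE mulrA sqrtrM -?expr2 ?sqr_ge0 // sqrtr_sqr ger0_norm.
rewrite -ler_pdivrMr // mulrC -hnormE -hZ -linearZ.
by apply: hnorm_le_opnorm; rewrite hZ hnormE mulVf ?gt_eqF.
Qed.

End OperatorNorm.

(** * The norm is determined by the irreducible representations *)

Section NormFromRepresentations.
Variables (R : realType) (A : cstarAlgType R).
Implicit Types (a b e g t : A) (pi : fdrep A) (r : R).
Local Infix "**" := cmul (at level 40, left associativity).
Local Notation star := (@cstar R A).

(** For w = pi(a^* a) v, |w|^2 = <pi(a) v, pi(a) w> <= r |v| r |w|. *)
Lemma bounded_by_starM pi a r : bounded_by pi a r ->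
  bounded_by pi (star a ** a) (r ^+ 2).
Proof.
move=> br v; set w := pi _ v; have [w0|w0] := leP (rdot w w) 0.
  by rewrite (rdot_eq0 w0) rdot0l mulr_ge0 ?sqr_ge0 ?rdot_ge0.
have ww : rdot w w = rdot (pi a v) (pi a w).
  by rewrite {1}/w repMv rdot_rep cstarK.
rewrite -(ler_pM2r w0) -expr2 {1}ww; apply: le_trans (rdot_CauchySchwarz _ _) _.
have -> : (r ^+ 2) ^+ 2 * rdot v v * rdot w w = (r ^+ 2 * rdot v v) * (r ^+ 2 * rdot w w).
  by ring.
by apply: ler_pM; rewrite ?rdot_ge0.
Qed.

Lemma bounded_byZ pi a r (k : R) : bounded_by pi a r ->
  bounded_by pi (k%:C *: a) (k * r).
Proof.
move=> br v; rewrite repZv !rdotE mulrA -expr2 exprMn -[leRHS]mulrA.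
by apply: ler_wpM2l; [exact: sqr_ge0 | exact: br].
Qed.

Definition jointly_injective := forall a, (forall pi, pi a = 0) -> a = 0.

Lemma RFD_jointly_injective : RFD A -> jointly_injective.
Proof.
move=> [F sepF] a pia0; apply/eqP/negPn/negP => /sepF[pi _].
by rewrite pia0 eqxx.
Qed.

Section Isometry.
Hypothesis inj : jointly_injective.

(** The excess of g^2 vanishes in every representation, hence in A. *)
Lemma sa_unit_norm_le g : star g = g -> nrm g ^+ 2 <= 2 ->
  (forall pi, bounded_by pi g 1) -> nrm g <= 1.
Proof.
move=> sg g2 bg; have [e te] := excess_exists sg g2.
have e0 : e = 0.
  apply: inj => pi; apply: (excess_eq0 te) => v.
  by rewrite repMv rdot_rep sg; have := bg pi v; rewrite expr1n mul1r.
case: te => _ _ _; rewrite e0 addr0 subr0 -{1}sg nrm_starM.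
by rewrite expr_le1 ?nrm_ge0.
Qed.

(** If |g| > r, rescale by s = max(r, 3/4 |g|) < |g|: g / s is contractive in
every representation and has square norm at most 16/9 <= 2, so |g| <= s. *)
Lemma sa_norm_le g r : star g = g -> 0 <= r ->
  (forall pi, bounded_by pi g r) -> nrm g <= r.
Proof.
move=> sg r0 bg; rewrite leNgt; apply/negP => rg.
set s := Num.max r (3 / 4 * nrm g).
have rs : r <= s by rewrite le_max lexx.
have gs : 3 / 4 * nrm g <= s by rewrite le_max lexx orbT.
have sg1 : s < nrm g by rewrite gt_max rg /=; lra.
have s0 : 0 < s by lra.
have nZ : nrm (s^-1%:C *: g) = s^-1 * nrm g.
  by rewrite nrmZr ger0_norm // invr_ge0 ltW.
suff : nrm (s^-1%:C *: g) <= 1 by rewrite nZ ler_pdivrMl // mulr1 leNgt sg1.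
apply: sa_unit_norm_le => [||pi]; first by rewrite starZr sg.
  rewrite nZ mulrC exprMn exprVn ler_pdivrMr ?exprn_gt0 //.
  by nra.
rewrite -(mulVf (lt0r_neq0 s0)); apply: bounded_byZ.
by apply: bounded_by_le (bg pi); rewrite r0.
Qed.

Lemma norm_le_of_irreducible a r : 0 <= r ->
  (forall pi, irreducible pi -> bounded_by pi a r) -> nrm a <= r.
Proof.
move=> r0 /bounded_by_irreducible ba.
rewrite -(@ler_pXn2r _ 2) ?nnegrE ?nrm_ge0 // -nrm_starM.
apply: sa_norm_le => [||pi]; first by rewrite cstarM cstarK.
  exact: sqr_ge0.
exact: bounded_by_starM.
Qed.

End Isometry.

Lemma fd_norm_attaining_of_le pi b :
  irreducible pi -> nrm b <= opnorm (pi b) -> fd_norm_attaining b.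
Proof.
move=> irr le_b; exists (rep_dim pi); exists pi; first by split.
rewrite nrmE; congr (_%:C); apply/eqP; rewrite eq_le le_b.
by rewrite opnorm_le ?nrm_ge0 //; exact: rep_contraction.
Qed.

(** * Perturbation to a norm-attaining element *)

(** The element a' is a rescaled so that |pi(a')| = 1, and b' = a' - a' e with e
the excess of (a'^* a')^2. *)
Lemma attaining_near a (d : R) : jointly_injective -> a != 0 -> 0 < d <= 1 ->
  exists2 b, fd_norm_attaining b & nrm (a - b) <= d * nrm a.
Proof.
move=> inj a0 /andP[d0 d1]; set N := nrm a.
have N0 : 0 < N.
  by rewrite lt_def nrm_ge0 andbT; apply: contra a0 => /eqP/nrm0_eq0 ->.
(* (1 + d / 15)^4 <= 1 + d for d <= 1, which bounds |a'|^4. *)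
have dN0 : 0 < 1 + d / 15 by lra.
have [pi [irr_pi lt_t]] : exists pi, irreducible pi /\ N < (1 + d / 15) * opnorm (pi a).
  apply: contrapT => /forallNP noPi.
  have : N <= (1 + d / 15)^-1 * N.
    apply: (norm_le_of_irreducible inj) => [|pi irr_pi].
      by rewrite mulr_ge0 ?invr_ge0 ?ltW.
    apply: bounded_by_le (@opnorm_bounded _ _ pi a).
    rewrite opnorm_ge0 ler_pdivlMl //= leNgt; apply/negP => lt_t.
    by apply: (noPi pi).
  by rewrite ler_pdivlMl // leNgt ltr_pMl //; lra.
set t := opnorm (pi a) in lt_t.
have t0 : 0 < t by rewrite -(pmulr_rgt0 _ dN0); apply: lt_trans lt_t.
set a' := t^-1%:C *: a.
have na' : nrm a' = t^-1 * N by rewrite nrmZr ger0_norm // invr_ge0 ltW.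
have na'_ge0 : 0 <= nrm a' by exact: nrm_ge0.
have na'_le : nrm a' <= 1 + d / 15 by rewrite na' ler_pdivrMl // mulrC ltW.
set g := star a' ** a'.
have sg : star g = g by rewrite cstarM cstarK.
have ng : nrm g = nrm a' ^+ 2 by rewrite nrm_starM.
have ngg : nrm g ^+ 2 <= 1 + d.
  rewrite ng; have : nrm a' ^+ 2 <= 1 + d / 5 by nra.
  by have := sqr_ge0 (nrm a'); nra.
have [|e te] := excess_exists sg (_ : nrm g ^+ 2 <= 2); first by lra.
have [_ se _ _] := te.
have ntk : nrm (g ** g) <= 1 + d by rewrite -{1}sg nrm_starM.
have kd : 0 < 1 + d by lra.
have Ele rho v := @excess_le _ _ rho _ _ te (1 + d) v kd ntk.
have E0 rho v := @excess_ge0 _ _ rho _ _ te v.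
have Esq rho (v : rep_space rho) : rdot (rho e v) (rho e v) <= rdot (rho e v) v.
  by have := Ele rho v; have := E0 rho v; nra.
(* |E v - d v|^2 >= 0 turns |E v|^2 <= d <E v, v> into |E v| <= d |v|. *)
have ne : nrm e <= d.
  apply: (norm_le_of_irreducible inj); first exact: ltW.
  move=> rho _ v; have := Ele rho v; have := rdot_ge0 (rho e v - d%:C *: v).
  by rewrite !rdotE (rdotC v (rho e v)); nra.
set b' := a' - a' ** e.
(* b'^* b' = (1 - e) g (1 - e), where 1 - e is a contraction and
   |g w|^2 = <g^2 w, w> for w = (1 - e) v. *)
have nb' : nrm b' <= 1.
  rewrite -(@ler_pXn2r _ 2) ?nnegrE ?nrm_ge0 // -nrm_starM expr1n.
  apply: (norm_le_of_irreducible inj) => // rho _ v; rewrite expr1n mul1r.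
  have -> : rho (star b' ** b') v =
      rho g (v - rho e v) - rho e (rho g (v - rho e v)).
    rewrite !repMv starB cstarM se !repBv !repMv.
    by rewrite -linearB.
  apply: le_trans (one_sub_excess_contraction te (Esq rho) _) _.
  by rewrite rdot_rep sg -repMv rdotC; apply: (excess_weight_le1 te).
have pie0 : pi e = 0.
  apply: (excess_eq0 te) => v.
  rewrite repMv rdot_rep sg.
  have ba' : bounded_by pi a' 1.
    by rewrite -(mulVf (lt0r_neq0 t0)); apply: bounded_byZ; apply: opnorm_bounded.
  by have := bounded_by_starM ba' v; rewrite !expr1n mul1r.
have ta' : t%:C *: a' = a by rewrite scalerA -rmorphM mulfV ?gt_eqF // scale1r.
exists (t%:C *: b').
  apply: (fd_norm_attaining_of_le irr_pi).
  have -> : pi (t%:C *: b') = pi a.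
    by rewrite scalerBr ta' linearB linearZ /= repM pie0 comp_lfun0r scaler0 subr0.
  by rewrite nrmZr (ger0_norm (ltW t0)) ger_pMr.
have -> : a - t%:C *: b' = a ** e.
  by rewrite scalerBr ta' -cmulZl ta'; abelian.
by apply: le_trans (ler_nrmM _ _) _; rewrite mulrC ler_wpM2r // nrm_ge0.
Qed.

End NormFromRepresentations.

(** * The zero representation on a line *)

Section ZeroRepresentation.
Variables (R : realType) (A : cstarAlgType R).

Definition line_dot (x y : R[i]^o) : R[i] := x * Num.conj y.

Lemma line_dot_bilinear : bilinear_for *%R (Num.conj \; *%R) line_dot.
Proof.
split=> x k y z; rewrite /line_dot /=.
  by rewrite mulrDl mulrA.
by rewrite rmorphD rmorphM mulrDr mulrCA.
Qed.

HB.instance Definition _ := bilinear_isBilinear.Build R[i] R[i]^o R[i]^o R[i]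
  *%R (Num.conj \; *%R) line_dot line_dot_bilinear.

Lemma line_dot_hermitian x y :
  line_dot x y = (-1) ^+ false * Num.conj (line_dot y x).
Proof. by rewrite expr0 mul1r /line_dot rmorphM /= conjCK mulrC. Qed.

HB.instance Definition _ := isHermitianSesquilinear.Build R[i] R[i]^o
  false Num.conj line_dot line_dot_hermitian.

Lemma line_dot_gt0 x : x != 0 -> 0 < line_dot x x.
Proof. by move=> x0; rewrite /line_dot mul_conjC_gt0. Qed.

HB.instance Definition _ := isDotProduct.Build R[i] R[i]^o
  line_dot line_dot_gt0.

(** It supplies the irreducible representation in which 0 attains its norm, even
when A = 0. *)
Definition complex_line : fdHilbert R := FdHilbert (line_dot : {dot R[i]^o for Num.conj}).

Definition zero_map (_ : A) : 'End(complex_line) := 0.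

Lemma zero_map_linear : linear zero_map.
Proof. by move=> k a b; rewrite /zero_map scaler0 addr0. Qed.

HB.instance Definition _ := GRing.isLinear.Build R[i] A 'End(complex_line) *:%R
  zero_map zero_map_linear.

Lemma zero_mapM a b : zero_map (cmul a b) = (zero_map a \o zero_map b)%VF.
Proof. by rewrite /zero_map comp_lfun0l. Qed.

Lemma zero_map_star a x y :
  hdot complex_line (zero_map a x) y = hdot complex_line x (zero_map (cstar a) y).
Proof. by rewrite !lfunE /= linear0l linear0r. Qed.

Definition zero_rep : fdrep A := @FdRep R A complex_line zero_map zero_mapM zero_map_star.

Lemma zero_rep_irreducible : irreducible zero_rep.
Proof.
have dim1 : rep_dim zero_rep = 1%N by rewrite /rep_dim dimvf.
split=> [|V _]; first by rewrite dim1.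
have [/eqP V0|V0] := boolP (\dim V == 0%N).
  by left; apply/eqP; rewrite -dimv_eq0; apply/eqP.
by right; apply/eqP; rewrite eqEdim subvf; rewrite -/(rep_dim zero_rep) dim1 lt0n.
Qed.

Lemma zero_attaining : fd_norm_attaining (0 : A).
Proof.
by apply: (fd_norm_attaining_of_le zero_rep_irreducible); rewrite nrm0 opnorm_ge0.
Qed.

End ZeroRepresentation.

(** * The equivalence *)

Lemma open_nrm_ball (R : realType) (A : cstarAlgType R) (O : set A) (a : A) :
  open O -> O a -> exists2 e : R, 0 < e & forall b, nrm (a - b) < e -> O b.
Proof.
move=> openO Oa; have /nbhs_ballP[e /= e0 ballO] := open_nbhs_nbhs (conj openO Oa).
have eE : (complex.Re e)%:C = e by rewrite RRe_real // realE ltW.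
exists (complex.Re e); first by rewrite -ltcR eE.
by move=> b ab; apply: ballO; rewrite -ball_normE /= nrmE -eE ltcR.
Qed.

Lemma dense_nrm_ball (R : realType) (A : cstarAlgType R) (S : set A) (a : A) (e : R) :
  dense S -> 0 < e -> exists2 b, S b & nrm (a - b) < e.
Proof.
move=> denseS e0; have eC0 : 0 < e%:C by rewrite ltcR.
have [||b [bO bS]] := denseS (ball a e%:C)^°.
- by exists a; apply: nbhsx_ballx.
- exact: open_interior.
exists b => //; have := interior_subset bO.
by rewrite -ball_normE /= nrmE ltcR.
Qed.

Lemma dense_fd_norm_attaining_RFD (R : realType) (A : cstarAlgType R) :
  dense (@fd_norm_attaining R A) -> RFD A.
Proof.
move=> denseA; exists (fun=> True) => a a0; apply: contrapT => no_pi.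
have pia0 (pi : fdrep A) : pi a = 0.
  by apply/eqP/negPn/negP => pia; apply: no_pi; exists pi.
have na : 0 < nrm a.
  by rewrite lt_def nrm_ge0 andbT; apply: contra a0 => /eqP/nrm0_eq0 ->.
have [|b [n [pi _ nb]] ab] := dense_nrm_ball a denseA (_ : 0 < nrm a / 2).
  by rewrite divr_gt0.
have : nrm b <= nrm (a - b).
  have -> : nrm b = opnorm (pi b) by apply: complexI; rewrite -nrmE.
  apply: opnorm_le; first exact: nrm_ge0.
  move=> v; have := rep_contraction (pi := pi) (b - a) v.
  by rewrite nrmBC repBv pia0 lfunE /= subr0.
have := ler_nrmD (a - b) b; rewrite subrK; lra.
Qed.

Theorem corollary3p3 (R : realType) (A : cstarAlgType R) :
  dense (@fd_norm_attaining R A) <-> RFD A.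
Proof.
split; first exact: dense_fd_norm_attaining_RFD.
move=> /RFD_jointly_injective inj O [a Oa] openO.
have [a0|a0] := eqVneq a 0; first by exists 0; split; rewrite -?a0 // a0; exact: zero_attaining.
have [e e0 ballO] := open_nrm_ball openO Oa.
have na : 0 < nrm a.
  by rewrite lt_def nrm_ge0 andbT; apply: contra a0 => /eqP/nrm0_eq0 ->.
pose d := Num.min 1 (e / 2 / nrm a).
have d_bounds : 0 < d <= 1 by rewrite lt_min ltr01 !divr_gt0 //= ge_min lexx.
have [b attb ab] := attaining_near inj a0 d_bounds.
exists b; split=> //; apply: ballO; apply: le_lt_trans ab _.
rewrite -ltr_pdivlMr // /d gt_min; apply/orP; right.
by rewrite ltr_pM2r ?invr_gt0 //; lra.
Qed.
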